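(* Let $n > 1$ and $k \geq 0$ be integers and let $G$ be a finite simple graph with $|V(G)| \leq 2k + 3n + 4$. If for every edge $e \in E(G)$ the graph $G - V(e)$ is $(n,k)$-extendable, then $G$ is $(n+2,k)$-extendable.
   Context: A $k$-matching is a matching with $k$ edges; a 1-factor is a perfect matching. For $S \subseteq V(G)$, $G - S$ is the subgraph induced on $V(G)\setminus S$; for an edge $e$, $V(e)$ is its set of endpoints. For non-negative integers $n,k$, a graph $H$ is $(n,k)$-extendable if $n + 2k \leq |V(H)| - 2$, $|V(H)| - n$ is even, and for every set $S$ of $n$ vertices of $H$, the graph $H - S$ contains a $k$-matching and every $k$-matching of $H - S$ can be extended to a 1-factor of $H - S$.
   Formalization: The formal theorem additionally assumes that G has at least one edge; for an edgeless G the condition on every edge is vacuous while G is never (n+2,k)-extendable, so the claim fails there. *)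

(* Defs.v *)
From mathcomp Require Import all_boot.

Set Implicit Arguments.
Unset Strict Implicit.
Unset Printing Implicit Defensive.

(* A finite simple graph whose vertex set is any finite subset
   of an ambient finType; an edge is the two-element set of its endpoints, so
   that the set V(e) of endpoints of an edge e is e itself. *)
Record sgraph (T : finType) := SGraph {
  verts : {set T};
  edges : {set {set T}};
  edgesP : forall e : {set T}, e \in edges -> (e \subset verts) && (#|e| == 2)
}.

Lemma del_edgesP (T : finType) (G : sgraph T) (S : {set T}) (e : {set T}) :
  e \in [set f in edges G | f \subset verts G :\: S] ->
  (e \subset verts G :\: S) && (#|e| == 2).
Proof. by rewrite inE => /andP[/edgesP/andP[_ ->] ->]. Qed.

(* G - S, the subgraph of G induced on V(G) \ S. *)
Definition del_verts (T : finType) (G : sgraph T) (S : {set T}) : sgraph T :=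
  SGraph (@del_edgesP T G S).

Definition matching (T : finType) (G : sgraph T) (M : {set {set T}}) : Prop :=
  M \subset edges G /\ {in M &, forall e f : {set T}, e != f -> [disjoint e & f]}.

Definition k_matching (T : finType) (G : sgraph T) (k : nat)
    (M : {set {set T}}) : Prop :=
  matching G M /\ #|M| = k.

Definition one_factor (T : finType) (G : sgraph T) (F : {set {set T}}) : Prop :=
  matching G F /\ cover F = verts G.

(* n + 2k <= |V(H)| - 2 is stated without subtraction, which truncates on nat;
   it makes the subtraction in the parity condition exact. *)
Definition extendable (T : finType) (n k : nat) (H : sgraph T) : Prop :=
  [/\ n + 2 * k + 2 <= #|verts H|,
      ~~ odd (#|verts H| - n) &
      forall S : {set T}, S \subset verts H -> #|S| = n ->
        (exists M, k_matching (del_verts H S) k M) /\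
        (forall M, k_matching (del_verts H S) k M ->
           exists2 F, one_factor (del_verts H S) F & M \subset F)].

(* Main.v *)
Require Import Defs.
From mathcomp Require Import all_boot.
From mathcomp Require Import zify.

Set Implicit Arguments.
Unset Strict Implicit.
Unset Printing Implicit Defensive.

(** Let [S] be a set of [n + 2] vertices. If [S] contains an edge [e], then
    [G - S] is [G - V(e)] with [n] further vertices removed, and the hypothesis
    applies. Otherwise [S] is independent, and this is impossible: for every
    edge [e], every [n]-set and every matching of at most [k] edges, the rest
    of the graph has a 1-factor, so at most half of it is independent. Applied
    to an edge outside [S] and as many deleted vertices outside [S] as possible,
    this contradicts [|V(G)| <= 2k + 3n + 4]; without an edge outside [S] the
    graph is bipartite up to the given matching, and deleting vertices from
    one side only gives the contradiction. Matchings of fewer than [k] edges are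
    needed on the way, and are extended by Plummer's exchange argument. *)

(** Supplies the deleted sets of exactly [n + 2] vertices and the [k]-matching of the exchange
    argument. *)
Lemma subset_sandwich (T : finType) (A B : {set T}) (m : nat) :
  A \subset B -> #|A| <= m -> m <= #|B| ->
  exists W : {set T}, [/\ A \subset W, W \subset B & #|W| = m].
Proof.
move=> sAB leAm; elim: m leAm => [|m IHm] leAm lemB.
  by exists A; split=> //; apply/eqP; rewrite -leqn0.
move: leAm; rewrite leq_eqVlt => /predU1P[eqA|ltA]; first by exists A.
have [W [sAW sWB cW]] := IHm ltA (ltnW lemB).
have /properP[_ [x Bx Wx]] : W \proper B by rewrite properEcard sWB cW.
exists (x |: W); split; first exact: subset_trans sAW (subsetU1 x W).
  by rewrite subUset sub1set Bx.
by rewrite cardsU1 Wx cW.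
Qed.

(** * Matchings, their covers, and 1-factors of induced subgraphs *)

Section Matchings.
Context {T : finType}.
Implicit Types (G : sgraph T) (M F : {set {set T}}) (e S W I : {set T}).

Lemma edge_card {G e} : e \in edges G -> #|e| = 2.
Proof. by case/edgesP/andP=> _ /eqP. Qed.

Lemma edge_sub {G e} : e \in edges G -> e \subset verts G.
Proof. by case/edgesP/andP. Qed.

Lemma matching_edge {G M e} : matching G M -> e \in M -> e \in edges G.
Proof. by case=> /subsetP sM _ /sM. Qed.

Lemma matching_sub {G M F} : M \subset F -> matching G F -> matching G M.
Proof.
move=> sMF [sF dF]; split; first exact: subset_trans sF.
by move=> e f Me Mf; apply: dF; apply: (subsetP sMF).
Qed.

Lemma matching_trivIset {G M} : matching G M -> trivIset M.
Proof. by case=> _ dM; apply/trivIsetP. Qed.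

Lemma card_cover_matching {G M} : matching G M -> #|cover M| = 2 * #|M|.
Proof.
move=> mM; rewrite -(eqP (matching_trivIset mM)) mulnC -sum_nat_const.
by apply: eq_bigr => e /(matching_edge mM)/edge_card.
Qed.

Lemma cover_matching_sub {G M} : matching G M -> cover M \subset verts G.
Proof.
by move=> mM; apply/bigcupsP => e /(matching_edge mM); apply: edge_sub.
Qed.

Lemma cover_subset {M F} : M \subset F -> cover M \subset cover F.
Proof.
move=> sMF; apply/bigcupsP => e Me.
by apply: bigcup_sup; apply: (subsetP sMF).
Qed.

Lemma cover0 : cover (set0 : {set {set T}}) = set0.
Proof. by rewrite /cover big_set0. Qed.

Lemma cover_setU1 e M : cover (e |: M) = e :|: cover M.
Proof. by rewrite /cover bigcup_setU big_set1. Qed.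

Lemma matching0 G : matching G set0.
Proof. by split=> [|e f]; rewrite ?sub0set ?inE. Qed.

Lemma matching_setU1 {G M e} : matching G M -> e \in edges G ->
  [disjoint e & cover M] -> matching G (e |: M).
Proof.
move=> [sM dM] Ge dis; split; first by rewrite subUset sub1set Ge.
have dis1 f : f \in M -> [disjoint e & f].
  by move=> Mf; apply: disjointWr dis; apply: bigcup_sup.
move=> f g /setU1P[->|Mf] /setU1P[->|Mg] //; first by rewrite eqxx.
- by move=> _; apply: dis1.
- by move=> _; rewrite disjoint_sym; apply: dis1.
- exact: dM.
Qed.

Lemma disjoint_matching_rem {G M e} : matching G M -> e \in M ->
  [disjoint e & cover (M :\ e)].
Proof.
move=> mM Me; rewrite disjoint_sym disjoints_subset.
apply/bigcupsP => f /setD1P[nfe Mf].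
by rewrite -disjoints_subset; case: mM => _; apply.
Qed.

Lemma matching_del_verts G S M :
  matching (del_verts G S) M <->
  matching G M /\ cover M \subset verts G :\: S.
Proof.
split=> [mM|[[sM dM] sC]].
  split; last exact: (cover_matching_sub mM).
  case: mM => sM dM; split=> //; apply: subset_trans sM _.
  by apply/subsetP => e; rewrite inE => /andP[].
split=> //; apply/subsetP => e Me; rewrite inE (subsetP sM) //=.
by apply: subset_trans sC; apply: bigcup_sup.
Qed.

Lemma one_factor_del_verts G S F :
  one_factor (del_verts G S) F <->
  matching G F /\ cover F = verts G :\: S.
Proof.
split=> [[/matching_del_verts[mF _] cF] //|[mF cF]].
by split=> //; apply/matching_del_verts; rewrite cF.
Qed.

(* Plummer's exchange: as long as a 1-factor [F] misses an edge [f] of [M],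
   replacing the at most two edges of [F] meeting [f] by [f] leaves at least [k]
   edges, among which we find a [k]-matching containing [f] and [M :&: F]. *)
Lemma extend_small_matching G k M :
  2 * k + 2 <= #|verts G| ->
  (exists M0, k_matching G k M0) ->
  (forall M0, k_matching G k M0 -> exists2 F, one_factor G F & M0 \subset F) ->
  matching G M -> #|M| <= k ->
  exists2 F, one_factor G F & M \subset F.
Proof.
move=> leV [M0 /[swap] ext /ext[F0 F0f _]] mM leM.
have [m] := ubnP #|M :\: F0|; elim: m => // m IHm in F0 F0f *.
have [sMF _|/subsetPn[f Mf nFf] ltm] := boolP (M \subset F0).
  by exists F0.
have [mF cF] := F0f; have dM := mM.2.
(* The surplus edge matters: the exchange drops at most two edges of [F0] and adds [f], so at least
   [k] remain. *)
have leF : k.+1 <= #|F0|.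
  by have := card_cover_matching mF; rewrite cF; lia.
pose F1 := [set g in F0 | [disjoint g & f]].
have sF1 : F1 \subset F0 by apply/subsetP => g; rewrite inE => /andP[].
have cF1 : #|F0 :\: F1| <= 2.
  rewrite -(edge_card (matching_edge mM Mf)).
  apply: leq_trans (leq_imset_card (pblock F0) f); apply: subset_leq_card.
  apply/subsetP => g /setDP[Fg]; rewrite inE Fg /= => /pred0Pn[x /andP[gx fx]].
  apply/imsetP; exists x => //.
  by rewrite (def_pblock (matching_trivIset mF) Fg gx).
have nF1f : f \notin F1 by apply: contra nFf; apply: (subsetP sF1).
have leF1 : k <= #|f |: F1|.
  by rewrite cardsU1 nF1f; have := cardsID F1 F0; rewrite (setIidPr sF1); lia.
have sN : f |: (M :&: F0) \subset f |: F1.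
  apply: setUS; apply/subsetP => g /setIP[Mg Fg]; rewrite inE Fg /=.
  by apply: dM => //; apply: contraNneq nFf => <-.
have leN : #|f |: (M :&: F0)| <= k.
  apply: leq_trans leM; apply: subset_leq_card.
  by rewrite subUset sub1set Mf subsetIl.
have [K [sNK sK cK]] := subset_sandwich sN leN leF1.
have mF1 : matching G (f |: F1).
  apply: matching_setU1 (matching_sub sF1 mF) (matching_edge mM Mf) _.
  rewrite disjoint_sym disjoints_subset; apply/bigcupsP => g.
  by rewrite inE -disjoints_subset => /andP[].
have [F Ff sKF] := ext K (conj (matching_sub sK mF1) cK).
apply: IHm Ff _; apply: leq_trans (ltm : _ <= m); apply: proper_card.
apply/properP; split.
  apply/subsetP => g /setDP[Mg nFg]; rewrite inE Mg andbT.
  apply: contra nFg => F0g; apply: (subsetP sKF); apply: (subsetP sNK).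
  by rewrite !inE Mg F0g orbT.
exists f; first by rewrite inE nFf.
rewrite inE negb_and negbK (subsetP sKF) // (subsetP sNK) //.
by rewrite setU11.
Qed.

(** * Independent sets against matchings *)

Definition independent G I := [forall e in edges G, ~~ (e \subset I)].

Lemma independentP {G I} :
  reflect (forall e, e \in edges G -> ~~ (e \subset I)) (independent G I).
Proof. exact: forall_inP. Qed.

Lemma independentPn {G I} :
  reflect (exists2 e, e \in edges G & e \subset I) (~~ independent G I).
Proof.
rewrite /independent negb_forall_in.
by apply: (iffP exists_inP) => -[e Ge]; exists e => //; apply/negPn.
Qed.

Lemma independent_sub {G I} {J : {set T}} :
  I \subset J -> independent G J -> independent G I.
Proof.
move=> sIJ /independentP iJ; apply/independentP => e /iJ.
by apply: contra => /subset_trans; apply.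
Qed.

(** Each edge of [F] has at most one end in [I], so sending a vertex of [I] to its edge [pblock F x]
    is injective. *)
Lemma card_independent_cover {G F I} :
  matching G F -> independent G I -> I \subset cover F ->
  2 * #|I| <= #|cover F|.
Proof.
move=> mF /independentP iI sI; rewrite (card_cover_matching mF) leq_mul2l /=.
have tF := matching_trivIset mF.
rewrite -(card_in_imset (f := pblock F) (D := mem I)).
  apply: subset_leq_card; apply/subsetP => e /imsetP[x Ix ->].
  by apply: pblock_mem; apply: (subsetP sI).
move=> x y Ix Iy eqb; apply: contraTeq isT => nxy.
have Fx : pblock F x \in F by apply: pblock_mem; apply: (subsetP sI).
have xF : x \in pblock F x by rewrite mem_pblock (subsetP sI).
have yF : y \in pblock F x by rewrite eqb mem_pblock (subsetP sI).
have Gx := matching_edge mF Fx.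
have /eqP eqe : [set x; y] == pblock F x.
  by rewrite eqEcard subUset !sub1set xF yF (edge_card Gx) cards2 nxy.
by have := iI _ Gx; rewrite -eqe subUset !sub1set Ix Iy.
Qed.

End Matchings.

(** * Consequences of the extendability of every [G - V(e)] *)

Section EdgeDeletion.
Context {T : finType} (G : sgraph T) (n k : nat).
Context (edge_ext :
  forall e : {set T}, e \in edges G -> extendable n k (del_verts G e)).
Implicit Types (M F : {set {set T}}) (e S W I : {set T}).

Lemma card_verts_lower e : e \in edges G -> n + 2 * k + 4 <= #|verts G|.
Proof.
move=> Ge; have [+ _ _] := edge_ext Ge.
rewrite /= cardsDS ?edge_sub // (edge_card Ge).
by have := subset_leq_card (edge_sub Ge); rewrite (edge_card Ge); lia.
Qed.

(** [G - W] is [G - V(e)] with the [n] vertices of [W :\: e] deleted; matchings with fewer than [k]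
    edges are handled by [extend_small_matching]. *)
Lemma extend_off_edge e W M :
  e \in edges G -> e \subset W -> W \subset verts G -> #|W| = n + 2 ->
  matching G M -> cover M \subset verts G :\: W -> #|M| <= k ->
  exists F, [/\ matching G F, cover F = verts G :\: W & M \subset F].
Proof.
move=> Ge seW sWV cW mM sM leM.
have ce := edge_card Ge; have seV := edge_sub Ge.
have cWe : #|W :\: e| = n by rewrite cardsDS // cW ce; lia.
have sWe : W :\: e \subset verts (del_verts G e) by apply: setSD.
have [leV _ /(_ _ sWe cWe) [exM extM]] := edge_ext Ge.
have eqV : verts G :\: e :\: (W :\: e) = verts G :\: W.
  by rewrite setDDl -{1}(setIidPr seW) setID.
have leV' : 2 * k + 2 <= #|verts (del_verts (del_verts G e) (W :\: e))|.
  have := card_verts_lower Ge.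
  by rewrite /= eqV cardsDS // cW; lia.
have mM' : matching (del_verts (del_verts G e) (W :\: e)) M.
  apply/matching_del_verts; rewrite /= eqV; split=> //.
  by apply/matching_del_verts; split=> //; apply: subset_trans sM (setDS _ seW).
have [F /one_factor_del_verts] := extend_small_matching leV' exM extM mM' leM.
by rewrite /= eqV => -[/matching_del_verts[mF _] cF] sMF; exists F.
Qed.

(** If [F] is a 1-factor of [G - W] containing [M], then [F :\: M] perfectly matches the vertices
    outside [W] and [M], so [I] takes at most half of them. *)
Lemma card_independent_off_edge e W M I :
  e \in edges G -> e \subset W -> W \subset verts G -> #|W| = n + 2 ->
  matching G M -> cover M \subset verts G :\: W -> #|M| <= k ->
  independent G I -> I \subset verts G :\: W :\: cover M ->
  2 * #|I| + 2 * #|M| + n + 2 <= #|verts G|.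
Proof.
move=> Ge seW sWV cW mM sM leM iI sI.
have [F [mF cF sMF]] := extend_off_edge Ge seW sWV cW mM sM leM.
have mFM : matching G (F :\: M) := matching_sub (subsetDl _ _) mF.
have := card_cover_matching mF.
rewrite cF cardsDS // cW; have := subset_leq_card sWV; rewrite cW.
have := cardsDS sMF; have := subset_leq_card sMF.
suff /(card_independent_cover mFM iI) : I \subset cover (F :\: M).
  by rewrite (card_cover_matching mFM); lia.
apply/subsetP => x /(subsetP sI) /setDP[]; rewrite -cF => /bigcupP[g Fg gx] nMx.
apply/bigcupP; exists g => //; rewrite inE Fg andbT.
by apply: contra nMx => Mg; apply/bigcupP; exists g.
Qed.

(** An independent rest would be at most half of itself, hence empty, but at least two vertices
    remain. *)
Lemma dependent_off_edge e W M :
  e \in edges G -> e \subset W -> W \subset verts G -> #|W| = n + 2 ->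
  matching G M -> cover M \subset verts G :\: W -> #|M| <= k ->
  ~~ independent G (verts G :\: W :\: cover M).
Proof.
move=> Ge seW sWV cW mM sM leM; apply/negP => iR.
have := card_independent_off_edge Ge seW sWV cW mM sM leM iR (subxx _).
rewrite !cardsDS // cW (card_cover_matching mM).
by have := card_verts_lower Ge; lia.
Qed.

(** Fills [e] up with vertices of [S]; deleting [W] in place of [S] then costs no vertex outside [S]
    except the ends of [e]. *)
Lemma edge_in_layer e S :
  e \in edges G -> S \subset verts G -> #|S| = n + 2 ->
  exists W, [/\ e \subset W, W \subset e :|: S, W \subset verts G
              & #|W| = n + 2].
Proof.
move=> Ge sSV cS.
have [||W [seW sW cW]] := subset_sandwich (subsetUl e S) (m := n + 2).
- by rewrite (edge_card Ge); lia.
- by rewrite -cS subset_leq_card ?subsetUr.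
by exists W; split=> //; apply: subset_trans sW _; rewrite subUset edge_sub.
Qed.

Lemma matching_edge_in_layer e S M :
  matching G M -> e \in M -> S \subset verts G -> #|S| = n + 2 ->
  cover M \subset verts G :\: S ->
  exists W, [/\ e \subset W, W \subset e :|: S, W \subset verts G, #|W| = n + 2
              & cover (M :\ e) \subset verts G :\: W].
Proof.
move=> mM Me sSV cS; rewrite subsetD => /andP[sMV dMS].
have [W [seW sW sWV cW]] := edge_in_layer (matching_edge mM Me) sSV cS.
have sMe : cover (M :\ e) \subset cover M := cover_subset (subsetDl _ _).
exists W; split=> //; rewrite subsetD (subset_trans sMe sMV) disjoint_sym.
apply: disjointWl sW _; rewrite disjoints_subset subUset -!disjoints_subset.
rewrite (disjoint_matching_rem mM Me) /= disjoint_sym.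
exact: disjointWl sMe dMS.
Qed.

(** Drives the greedy construction of a [k]-matching off [S]. An independent rest [Y] would stay
    almost whole when [S] is traded for a set containing an edge, and so exceed the half bound. *)
Lemma small_maximal_matching S M :
  edges G != set0 -> S \subset verts G -> #|S| = n + 2 ->
  matching G M -> cover M \subset verts G :\: S -> #|M| < k ->
  ~~ independent G (verts G :\: S :\: cover M).
Proof.
move=> /set0Pn[e0 Ge0] sSV cS mM sM ltM; apply/negP => iY.
set Y := verts G :\: S :\: cover M in iY.
have cY : #|Y| = #|verts G| - (n + 2) - 2 * #|M|.
  by rewrite !cardsDS // cS (card_cover_matching mM).
have leV := card_verts_lower Ge0.
(* With [M] empty, [e0] enters [W] and costs [Y] at most one vertex; the bound becomes
   [|V(G)| <= n + 4], impossible since [k > 0]. *)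
have [M0|[e Me]] := set_0Vmem M.
  have defY : Y = verts G :\: S by rewrite /Y M0 cover0 setD0.
  have [W [seW sWS sWV cW]] := edge_in_layer Ge0 sSV cS.
  have leYe : #|Y :&: e0| < 2.
    rewrite -(edge_card Ge0); apply: proper_card.
    rewrite properE subsetIr /= subsetI subxx andbT.
    by have /independentP := iY; apply.
  have iYe := independent_sub (subsetDl Y e0) iY.
  have sYe : Y :\: e0 \subset verts G :\: W :\: cover set0.
    by rewrite defY cover0 setD0 setDDl setUC; apply: setDS.
  have s0 : cover (set0 : {set {set T}}) \subset verts G :\: W.
    by rewrite cover0 sub0set.
  have := card_independent_off_edge Ge0 seW sWV cW (matching0 G) s0 _ iYe sYe.
  by have := cardsID e0 Y; rewrite M0 cards0 in cY ltM *;
    clear -cY leYe leV ltM; lia.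
(* An edge of [M] enters [W], so all of [Y] survives, and the bound gives
   [|V(G)| <= n + 2|M| + 4 < n + 2k + 4]. *)
have [W [seW sWS sWV cW sMeW]] := matching_edge_in_layer mM Me sSV cS sM.
have mMe : matching G (M :\ e) := matching_sub (subsetDl _ _) mM.
have sYR : Y \subset verts G :\: W :\: cover (M :\ e).
  rewrite /Y -{1}(setD1K Me) cover_setU1 !setDDl; apply: setDS.
  rewrite setUA; apply: setSU.
  by rewrite setUC.
have := card_independent_off_edge (matching_edge mM Me) seW sWV cW mMe sMeW _
  iY sYR.
by have := cardsD1 e M; rewrite Me; clear -cY leV ltM; lia.
Qed.

Lemma exists_matching S :
  edges G != set0 -> S \subset verts G -> #|S| = n + 2 ->
  exists M, [/\ matching G M, cover M \subset verts G :\: S & #|M| = k].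
Proof.
move=> G0 sSV cS; have := leqnn k.
elim: {1 3}k => [|j IHj] ltj.
  by exists set0; rewrite cover0 sub0set cards0; split=> //; apply: matching0.
have [M [mM sM cM]] := IHj (ltnW ltj).
have ltM : #|M| < k by rewrite cM.
have /independentPn[e Ge] := small_maximal_matching G0 sSV cS mM sM ltM.
rewrite subsetD => /andP[seS dis].
have nMe : e \notin M.
  apply: contraTN dis => Me.
  have /card_gt0P[x ex] : 0 < #|e| by rewrite (edge_card Ge).
  by apply/pred0Pn; exists x; rewrite /= ex; apply/bigcupP; exists e.
exists (e |: M); split; first exact: matching_setU1.
  by rewrite cover_setU1 subUset seS.
by rewrite cardsU1 nMe cM.
Qed.

Lemma not_independent_removed S M :
  0 < n -> #|verts G| <= 2 * k + 3 * n + 4 -> edges G != set0 ->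
  S \subset verts G -> #|S| = n + 2 ->
  matching G M -> cover M \subset verts G :\: S -> #|M| = k ->
  ~~ independent G S.
Proof.
move=> n0 hG /set0Pn[e0 Ge0] sSV cS mM sM cM; apply/negP => iS.
have leV := card_verts_lower Ge0.
have leM : #|M| <= k by rewrite cM.
set Y := verts G :\: S :\: cover M.
have cY : #|Y| = #|verts G| - (n + 2) - 2 * k.
  by rewrite !cardsDS // cS (card_cover_matching mM) cM.
pose H := verts G :\: cover M.
have sSH : S \subset H.
  by rewrite subsetD sSV disjoint_sym; move: sM; rewrite subsetD => /andP[].
have defY : Y = H :\: S by rewrite /Y /H !setDDl setUC.
have sYH : Y \subset H by rewrite defY subsetDl.
have cH : #|H| = #|Y| + (n + 2).
  by rewrite defY cardsDS // cS; have := subset_leq_card sSH; rewrite cS; lia.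
have sHV : H \subset verts G := subsetDl _ _.
have sMW W : W \subset H -> cover M \subset verts G :\: W.
  rewrite !subsetD cover_matching_sub // => /andP[_].
  by rewrite disjoint_sym.
have defR W : verts G :\: W :\: cover M = H :\: W.
  by rewrite /H !setDDl setUC.
(* Deleting all of [Y] leaves only vertices of the independent set [S]. *)
have noW e W : e \in edges G -> e \subset W -> Y \subset W -> W \subset H ->
    #|W| = n + 2 -> False.
  move=> Ge seW sYW sWH cW.
  have sWV := subset_trans sWH sHV.
  have /negP := dependent_off_edge Ge seW sWV cW mM (sMW _ sWH) leM.
  apply; rewrite defR; apply: independent_sub iS.
  apply: subset_trans (setDS _ sYW) _.
  by rewrite defY setDDr setDv set0U subsetIr.
(* Suppose first that [Y] contains an edge. If [|Y| < n + 2], some [W] containing [Y] contradicts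
   [noW]. Otherwise [W] fits inside [Y] and spares [S], whose independence gives
   [2k + 3n + 6 <= |V(G)|], against [hG]. *)
have [iY|/independentPn[e Ge seY]] := boolP (independent G Y); last first.
  have ce := edge_card Ge.
  have [leY|/ltnW gtY] := leqP (n + 2) #|Y|; last first.
    have [||W [sYW sWH cW]] := subset_sandwich sYH (m := n + 2) => //.
      by rewrite cH leq_addl.
    exact: (noW _ _ Ge (subset_trans seY sYW) sYW sWH cW).
  have [||W [seW sWY cW]] := subset_sandwich seY (m := n + 2) => //.
    by rewrite ce; clear; lia.
  have sWH := subset_trans sWY sYH.
  have sSR : S \subset verts G :\: W :\: cover M.
    rewrite defR subsetD sSH disjoint_sym; apply: disjointWl sWY _.
    by rewrite defY disjoint_sym disjoints_subset setCD subsetUr.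
  have := card_independent_off_edge Ge seW (subset_trans sWH sHV) cW mM
    (sMW _ sWH) leM iS sSR.
  by rewrite cS cM; clear -hG; lia.
(* If [H] has no edge, then [M] is nonempty because of [e0]; once an edge of [M] is moved into [W],
   only vertices of the independent set [H] remain. *)
have [iH|/independentPn[e Ge seH]] := boolP (independent G H).
  have [M0|[e Me]] := set_0Vmem M.
    have /independentP/(_ _ Ge0) := iH.
    by rewrite /H M0 cover0 setD0 edge_sub.
  have [W [seW sWS sWV cW sMeW]] := matching_edge_in_layer mM Me sSV cS sM.
  have mMe : matching G (M :\ e) := matching_sub (subsetDl _ _) mM.
  have leMe : #|M :\ e| <= k.
    by rewrite -cM subset_leq_card ?subsetDl.
  have /negP :=
    dependent_off_edge (matching_edge mM Me) seW sWV cW mMe sMeW leMe.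
  apply; apply: independent_sub iH.
  rewrite /H -{2}(setD1K Me) cover_setU1 setDDl; apply: setDS.
  exact: setSU.
have ce := edge_card Ge.
(* [S] and [Y] partition [H] and are both independent, so [e] has one end in each. *)
have small I : independent G I -> #|I :&: e| < 2.
  move=> /independentP iI; rewrite -ce; apply: proper_card.
  by rewrite properE subsetIr /= subsetI subxx andbT; apply: iI.
have cIe := cardsID e Y.
have ltY := small Y iY; have ltS := small S iS.
(* For [|Y| <= 2], [Y :|: e] has at most three vertices and fits into [W] because [n > 0]; [noW]
   concludes. *)
have [leY|gtY] := leqP #|Y| 2.
  have sYe : Y :|: e \subset H by rewrite subUset sYH.
  have [||W [sYW sWH cW]] := subset_sandwich sYe (m := n + 2).
  - have : e :\: Y \subset S :&: e.
      rewrite defY setDDr subUset subsetI subsetDl.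
      rewrite setIC subxx (_ : e :\: H = set0) ?sub0set //.
      by apply/eqP; rewrite setD_eq0.
    move/subset_leq_card; have := cardsU Y e; have := cardsID Y e.
    by rewrite setIC; clear -leY ltS n0 ce; lia.
  - by rewrite cH leq_addl.
  move: sYW; rewrite subUset => /andP[sYW seW].
  exact: (noW _ _ Ge seW sYW sWH cW).
(* Here [W] costs [Y] at most one vertex; as [|V(G)| = |Y| + n + 2 + 2k], the half bound for
   [Y :\: e] forces [|Y| <= 2]. *)
have [W [seW sWS sWV cW]] := edge_in_layer Ge sSV cS.
have sWH : W \subset H by apply: subset_trans sWS _; rewrite subUset seH.
have sYR : Y :\: e \subset verts G :\: W :\: cover M.
  by rewrite defR defY setDDl setUC; apply: setDS.
have := card_independent_off_edge Ge seW sWV cW mM (sMW _ sWH) leM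
  (independent_sub (subsetDl Y e) iY) sYR.
by rewrite cM; clear -cIe ltY cY gtY; lia.
Qed.

End EdgeDeletion.

Theorem theorem3 (T : finType) (G : sgraph T) (n k : nat)
  (hn : 1 < n)
  (hG : #|verts G| <= 2 * k + 3 * n + 4)
  (hE : edges G != set0)
  (hext : forall e : {set T}, e \in edges G -> extendable n k (del_verts G e)) :
  extendable (n + 2) k G.
Proof.
have /set0Pn[e0 Ge0] := hE.
have leV := card_verts_lower hext Ge0.
split; first by lia.
  have [_ + _] := hext _ Ge0.
  by rewrite /= cardsDS ?edge_sub // (edge_card Ge0) addnC subnDA.
move=> S sSV cS; split=> [|M [/matching_del_verts[mM sM] cM]].
  have [M [mM sM cM]] := exists_matching hext hE sSV cS.
  by exists M; split=> //; apply/matching_del_verts.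
(* The [k]-matching to be extended also serves as the matching in the independence argument; the
   edge found in [S] allows [W = S]. *)
have /independentPn[e Ge seS] :=
  not_independent_removed hext (ltnW hn) hG hE sSV cS mM sM cM.
have leM : #|M| <= k by rewrite cM.
have [F [mF cF sMF]] := extend_off_edge hext Ge seS sSV cS mM sM leM.
by exists F => //; apply/one_factor_del_verts.
Qed.
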